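(* For $j\in\{1,2\}$ let the two-point flux be $(J\boldsymbol f^j)^{\#}_{L,R}=(\phi^j_0,\phi^j_1,\phi^j_2)^{\mathrm T}$ with $\phi^j_0=\frac12[(Jhv^j)_L+(Jhv^j)_R]$ and, for $i\in\{1,2\}$, $$\phi^j_i=\tfrac14\big[(Jhv^jv^i)_L+(Jhv^jv^i)_R+(Jhv^j)_R(v^i)_L+(G^{ik}Jhv^j)_L(v_k)_R\big]+\tfrac g2(G^{ij}Jh)_Lh_R+\tfrac g2(G^{ij}Jh)_L(b_R-b_L).$$ Then this flux is entropy conservative: for arbitrary left and right states it satisfies the shuffle condition $$\boldsymbol w_R^{\mathrm T}(J\boldsymbol f^j)^{\#}_{R,L}-\boldsymbol w_L^{\mathrm T}(J\boldsymbol f^j)^{\#}_{L,R}=(J\varPsi^j)_R-(J\varPsi^j)_L,$$ where the contravariant flux potential components are $\varPsi^j=\boldsymbol w^{\mathrm T}\boldsymbol f^j-F^j=gh^2v^j/2$.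
   Context: Summation over Latin indices in $\{1,2\}$ repeated in upper and lower positions is implied ($j$ is free). Each state $(\cdot)_L$, $(\cdot)_R$ consists of a depth $h>0$, contravariant velocity components $v^1,v^2$, a symmetric positive-definite metric matrix $\boldsymbol G=(G_{ij})$ with inverse $(G^{ij})$, and a bottom topography value $b$; $J=\sqrt{\det\boldsymbol G}$, and $v_i=G_{ij}v^j$ (with each state's own metric). $g>0$ is constant. $(J\boldsymbol f^j)^{\#}_{R,L}$ is the same formula with the roles of $L$ and $R$ exchanged. For each state: entropy variables $\boldsymbol w=\big(g(h+b)-\frac12(v_1v^1+v_2v^2),\,v_1,\,v_2\big)^{\mathrm T}$; contravariant fluxes $\boldsymbol f^j=\big(hv^j,\ hv^1v^j+\frac g2h^2G^{1j},\ hv^2v^j+\frac g2h^2G^{2j}\big)^{\mathrm T}$; entropy flux $F^j=\frac12hv_iv^iv^j+gh^2v^j+ghbv^j$. *)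

(* Defs.v *)
From mathcomp Require Export all_boot all_order all_algebra.
From mathcomp Require Export reals.

Set Implicit Arguments.
Unset Strict Implicit.
Unset Printing Implicit Defensive.

Import Order.TTheory GRing.Theory Num.Theory.
Local Open Scope ring_scope.

(* Spatial indices 1, 2 are 'I_2; vectors of conserved quantities are blocks
   'cV_(1 + 2): the mass component followed by the two momentum components. *)

Definition dotc (R : realType) (n : nat) (x y : 'cV[R]_n) : R :=
  (x^T *m y) 0 0.

Definition posdefmx (R : realType) (n : nat) (A : 'M[R]_n) : Prop :=
  A^T = A /\ forall x : 'cV[R]_n, x != 0 -> 0 < dotc x (A *m x).

Record state (R : realType) := State {
  depth : R;
  vel : 'cV[R]_2;      (* contravariant components v^1, v^2 *)
  metric : 'M[R]_2;    (* covariant components G_ij *)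
  bottom : R;
  depth_gt0 : 0 < depth;
  metric_posdef : posdefmx metric
}.

Section ShallowWater.
Variables (R : realType) (g : R).
Implicit Types (s l r : state R) (i j k : 'I_2).

Definition vup s i : R := vel s i 0.
Definition vdn s i : R := \sum_(j < 2) metric s i j * vup s j.
Definition Gup s i j : R := invmx (metric s) i j.
Definition jac s : R := Num.sqrt (\det (metric s)).

Definition cons_vec (a : R) (u : 'I_2 -> R) : 'cV[R]_(1 + 2) :=
  col_mx a%:M (\col_(i < 2) u i).

Definition entropy_vars s : 'cV[R]_(1 + 2) :=
  cons_vec (g * (depth s + bottom s)
            - 2^-1 * \sum_(i < 2) vdn s i * vup s i)
           (vdn s).

Definition flux j s : 'cV[R]_(1 + 2) :=
  cons_vec (depth s * vup s j)
           (fun i => depth s * vup s i * vup s j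
                     + g / 2 * depth s ^+ 2 * Gup s i j).

Definition entropy_flux j s : R :=
  2^-1 * depth s * (\sum_(i < 2) vdn s i * vup s i) * vup s j
  + g * depth s ^+ 2 * vup s j
  + g * depth s * bottom s * vup s j.

Definition flux_potential j s : R :=
  dotc (entropy_vars s) (flux j s) - entropy_flux j s.

Definition mass_flux j s : R := jac s * depth s * vup s j.

(* Nonsymmetric: the first state is the local one, whose metric and topography
   weight the pressure and bottom terms. *)
Definition two_point_flux j l r : 'cV[R]_(1 + 2) :=
  cons_vec (2^-1 * (mass_flux j l + mass_flux j r))
           (fun i =>
              4^-1 * (mass_flux j l * vup l i + mass_flux j r * vup r i
                      + mass_flux j r * vup l i
                      + \sum_(k < 2) Gup l i k * mass_flux j l * vdn r k)
              + g / 2 * (Gup l i j * jac l * depth l) * depth r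
              + g / 2 * (Gup l i j * jac l * depth l) * (bottom r - bottom l)).

End ShallowWater.

(* Main.v *)
Require Import Defs.
From mathcomp Require Import ring.
Import Order.TTheory GRing.Theory Num.Theory.
Local Open Scope ring_scope.

(** Write [M = J h v^j] for the mass flux, [K = v_i v^i] for twice the kinetic
    energy per unit mass, and [<a, b> = v_i(a) v^i(b)] for the mixed pairing of
    two states.  This pairing is not symmetric, since each state lowers indices
    with its own metric.  When the entropy variables of the local state [r]
    are contracted with its two-point flux, the inverse metric of [r] meets the
    covariant velocity of [r] and raises it, so no metric survives, and
    - the term [- K(r) (M(l) + M(r)) / 4] coming from the mass component is
      cancelled by the momentum terms [M(r) v^i(r)] and [M(l) v^i(r)];
    - the remaining kinetic part is [(M(l) <r, l> + M(r) <l, r>) / 4], which is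
      invariant under exchanging [l] and [r];
    - the gravity part is [g/2] times
      [M(r) h(r) + (M(l) h(r) + M(r) h(l)) + M(l) b(r) + M(r) b(l)].
    The bracket and the bottom terms are also invariant under the exchange.
    Hence only [g/2 M h = J Psi^j] at each state survives in the difference of
    the two contractions ([dotc_entropy_two_point] and
    [flux_potentialE]). *)

(** A kernel vector of [A] would be isotropic for the quadratic form. *)
Lemma posdefmx_unitmx (R : realType) (n : nat) (A : 'M[R]_n) :
  posdefmx A -> A \in unitmx.
Proof.
move=> [A_sym A_pos]; rewrite unitmxE unitfE; apply/negP => /det0P [x x_neq0 xA].
have xT_neq0 : x^T != 0 by rewrite -trmx0 (inj_eq trmx_inj).
have := A_pos _ xT_neq0.
by rewrite -{1}A_sym -trmx_mul xA trmx0 /dotc mulmx0 mxE ltxx.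
Qed.

Lemma dotc_cons_vec (R : realType) (a c : R) (u v : 'I_2 -> R) :
  dotc (cons_vec a u) (cons_vec c v) = a * c + \sum_i u i * v i.
Proof.
rewrite /dotc /cons_vec tr_col_mx mul_row_col mxE; congr (_ + _).
  by rewrite tr_scalar_mx -scalar_mxM mxE eqxx.
by rewrite mxE; apply: eq_bigr => i _; rewrite !mxE.
Qed.

(** Symmetry of the metric matters here: the contraction is over the first
    index of the inverse, while [vdn] contracts the second index of the
    metric. *)
Lemma sum_vdn_Gup (R : realType) (s : state R) (k : 'I_2) :
  \sum_i vdn s i * Gup s i k = vup s k.
Proof.
have [G_sym _] := metric_posdef s.
have G_unit := posdefmx_unitmx _ _ _ (metric_posdef s).
have : ((metric s *m vel s)^T *m invmx (metric s)) 0 k = vup s k.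
  by rewrite trmx_mul G_sym mulmxK // mxE.
move=> <-; rewrite mxE; apply: eq_bigr => i _; rewrite !mxE /vdn /Gup.
by congr (_ * _); apply: eq_bigr.
Qed.

Lemma sum_vdn_Gup_vdn (R : realType) (m : R) (r l : state R) :
  \sum_i vdn r i * (\sum_k Gup r i k * m * vdn l k)
  = m * \sum_k vdn l k * vup r k.
Proof.
under eq_bigr => i _ do rewrite mulr_sumr.
rewrite exchange_big mulr_sumr; apply: eq_bigr => k _.
rewrite -(sum_vdn_Gup _ r k) !mulr_sumr; apply: eq_bigr => i _; ring.
Qed.

(** The entropy flux cancels everything but the work [g/2 h^2 G^{ij} v_i] of
    the pressure. *)
Lemma flux_potentialE (R : realType) (g : R) (j : 'I_2) (s : state R) :
  flux_potential g j s = g * depth s ^+ 2 * vup s j / 2.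
Proof.
rewrite /flux_potential /entropy_flux dotc_cons_vec.
have -> : \sum_i vdn s i * (depth s * vup s i * vup s j
                            + g / 2 * depth s ^+ 2 * Gup s i j)
  = depth s * vup s j * (\sum_i vdn s i * vup s i)
    + g / 2 * depth s ^+ 2 * vup s j.
  rewrite -{3}(sum_vdn_Gup _ s j) !mulr_sumr -big_split.
  by apply: eq_bigr => i _ /=; ring.
by field.
Qed.

(** Apart from the [mass_flux j r * depth r] term, the right-hand side is
    symmetric in [r] and [l]; this is the content of the shuffle condition. *)
Lemma dotc_entropy_two_point (R : realType) (g : R) (j : 'I_2)
    (r l : state R) :
  dotc (entropy_vars g r) (two_point_flux g j r l)
  = g / 2 * (mass_flux j r * depth r)
    + (g / 2 * (mass_flux j l * depth r + mass_flux j r * depth l)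
       + g / 2 * (mass_flux j l * bottom r + mass_flux j r * bottom l)
       + 4^-1 * (mass_flux j l * (\sum_i vdn r i * vup l i)
                 + mass_flux j r * (\sum_i vdn l i * vup r i))).
Proof.
rewrite dotc_cons_vec.
set cross := fun i : 'I_2 => \sum_k Gup r i k * mass_flux j r * vdn l k.
set P := jac r * depth r.
(* [c] and [d] abstract the depth of [l] and the jump of the bottom: both
   multiply the same contraction of [vdn r] with [Gup r]. *)
have -> : forall c d, \sum_i vdn r i
      * (4^-1 * (mass_flux j r * vup r i + mass_flux j l * vup l i
                 + mass_flux j l * vup r i + cross i)
         + g / 2 * (Gup r i j * jac r * depth r) * c
         + g / 2 * (Gup r i j * jac r * depth r) * d)
  = 4^-1 * (mass_flux j r + mass_flux j l) * (\sum_i vdn r i * vup r i)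
    + 4^-1 * mass_flux j l * (\sum_i vdn r i * vup l i)
    + 4^-1 * (\sum_i vdn r i * cross i)
    + g / 2 * P * (c + d) * (\sum_i vdn r i * Gup r i j).
  move=> c d; rewrite !mulr_sumr -!big_split; apply: eq_bigr => i _ /=.
  by rewrite /P; ring.
rewrite sum_vdn_Gup_vdn sum_vdn_Gup /P /mass_flux.
by field.
Qed.

Theorem lemma4 (R : realType) (g : R) (g_gt0 : 0 < g) (j : 'I_2) :
  (forall l r : state R,
     dotc (entropy_vars g r) (two_point_flux g j r l)
     - dotc (entropy_vars g l) (two_point_flux g j l r)
     = jac r * flux_potential g j r - jac l * flux_potential g j l)
  /\ (forall s : state R,
        flux_potential g j s = g * depth s ^+ 2 * vup s j / 2).
Proof.
split=> [l r|s]; last exact: flux_potentialE.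
rewrite !dotc_entropy_two_point !flux_potentialE /mass_flux; by field.
Qed.
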